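(* For every integer $n$ with $n\ge 8$, $$\mu(KG(n,2))=\mu_{\rm d}(KG(n,2))=\mu_{\rm o}(KG(n,2))=\mu_{\rm t}(KG(n,2))=\binom{n}{2}-4,$$ where $\mu,\mu_{\rm d},\mu_{\rm o},\mu_{\rm t}$ denote, respectively, the mutual-visibility, dual mutual-visibility, outer mutual-visibility and total mutual-visibility numbers and $KG(n,2)$ is the Kneser graph.
   Context: Kneser graph: $KG(n,k)$ has as vertices the $k$-element subsets of $[n]=\{1,\dots,n\}$; two vertices $A,B$ are adjacent if and only if $A\cap B=\emptyset$. Let $G$ be a connected graph, $\mathcal X\subseteq V(G)$ and $\overline{\mathcal X}=V(G)\setminus\mathcal X$. Two vertices $u,v\in V(G)$ are $\mathcal X$-visible if there is a shortest $u,v$-path $P$ in $G$ with no internal vertex in $\mathcal X$, i.e. $V(P)\cap\mathcal X\subseteq\{u,v\}$. The set $\mathcal X$ is: - a mutual-visibility set if any two vertices of $\mathcal X$ are $\mathcal X$-visible; - a total mutual-visibility set if any two vertices of $V(G)$ are $\mathcal X$-visible; - a dual mutual-visibility set if any two vertices of $\mathcal X$ are $\mathcal X$-visible and any two vertices of $\overline{\mathcal X}$ are $\mathcal X$-visible; - an outer mutual-visibility set if any two vertices $u,v$, at least one of which belongs to $\mathcal X$, are $\mathcal X$-visible. The numbers $\mu(G),\mu_{\rm t}(G),\mu_{\rm d}(G),\mu_{\rm o}(G)$ are the maximum cardinalities of a mutual-visibility, total mutual-visibility, dual mutual-visibility and outer mutual-visibility set in $G$, respectively. *)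

(* Defs.v *)
From mathcomp Require Import all_boot.

Set Implicit Arguments.
Unset Strict Implicit.
Unset Printing Implicit Defensive.

(* A finite simple graph is given by its adjacency relation [e : rel T] on the
   finite vertex type [T] (symmetric and irreflexive); see [kneser_sym],
   [kneser_irr] and [kneser2_connected] for the graphs of interest. *)
Section MutualVisibility.
Variables (T : finType) (e : rel T).
Implicit Types (X : {set T}) (u v w : T) (p q : seq T).

(* As in [path.v], a path is given by its first vertex [u] and the sequence [p]
   of the remaining ones, so that [size p] is its length. *)
Definition upath u v p := [&& path e u p, last u p == v & uniq (u :: p)].

Definition shortest_path u v p :=
  upath u v p &&
  [forall m : 'I_(size p), [forall q : m.-tuple T, ~~ upath u v q]].

(* V(P) :&: X is included in {u, v}, where V(P) = u :: p. *)
Definition avoids X u v p :=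
  all (fun w => (w \in X) ==> (w \in [set u; v])) (u :: p).

(* The bound on the length only makes the predicate boolean: see [visibleP].
   The case u = v is trivially true (take the path of length 0), so "any two
   vertices" may be read with or without distinctness below. *)
Definition visible X u v :=
  [exists m : 'I_#|T|, [exists p : m.-tuple T,
     shortest_path u v p && avoids X u v p]].

Definition mutual_visibility_set X :=
  [forall u in X, forall v in X, visible X u v].

Definition total_mutual_visibility_set X :=
  [forall u, forall v, visible X u v].

Definition dual_mutual_visibility_set X :=
  [forall u in X, forall v in X, visible X u v] &&
  [forall u in ~: X, forall v in ~: X, visible X u v].

Definition outer_mutual_visibility_set X :=
  [forall u, forall v, (u \in X) || (v \in X) ==> visible X u v].

Definition mu := \max_(X : {set T} | mutual_visibility_set X) #|X|.
Definition mu_t := \max_(X : {set T} | total_mutual_visibility_set X) #|X|.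
Definition mu_d := \max_(X : {set T} | dual_mutual_visibility_set X) #|X|.
Definition mu_o := \max_(X : {set T} | outer_mutual_visibility_set X) #|X|.

Lemma shortest_pathP u v p :
  reflect (upath u v p /\ forall q, upath u v q -> size p <= size q)
          (shortest_path u v p).
Proof.
apply: (iffP andP) => [[up /forallP H]|[up H]]; split=> //.
  move=> q uq; rewrite leqNgt; apply/negP => lt.
  by have /forallP/(_ (in_tuple q)) := H (Ordinal lt); rewrite /= uq.
apply/forallP => m; apply/forallP => q; apply/negP => /H.
by rewrite size_tuple leqNgt ltn_ord.
Qed.

Lemma visibleP X u v :
  reflect (exists2 p, shortest_path u v p & avoids X u v p) (visible X u v).
Proof.
apply: (iffP existsP) => [[m /existsP[p /andP[sp ap]]]|[p sp ap]].
  by exists p.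
have lt : size p < #|T|.
  have /andP[/and3P[_ _ up] _] := sp.
  by rewrite -[(size p).+1]/(size (u :: p)) -(card_uniqP up) max_card.
by exists (Ordinal lt); apply/existsP; exists (in_tuple p); rewrite /= sp.
Qed.

End MutualVisibility.

(* The ground set {1, ..., n} is represented by 'I_n. *)
Definition kneser_vertex (n k : nat) : finType :=
  {A : {set 'I_n} | #|A| == k}.

Definition KG (n k : nat) : rel (kneser_vertex n k) :=
  fun A B => [disjoint val A & val B].

Lemma kneser_sym n k : symmetric (@KG n k).
Proof. by move=> A B; rewrite /KG disjoint_sym. Qed.

Lemma kneser_irr n k : 0 < k -> irreflexive (@KG n k).
Proof.
move=> k0 A; apply/negP; rewrite /KG -setI_eq0 setIid -cards_eq0.
by rewrite (eqP (valP A)) eqn0Ngt k0.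
Qed.

Lemma kneser2_connected n (A B : kneser_vertex n 2) :
  5 <= n -> connect (@KG n 2) A B.
Proof.
move=> n5; have [dAB|ndAB] := boolP (KG A B); first exact: connect1.
have cU : #|val A :|: val B| <= 3.
  have : 0 < #|val A :&: val B| by rewrite card_gt0 setI_eq0.
  rewrite cardsU (eqP (valP A)) (eqP (valP B)).
  by case: #|_| => // m _; rewrite subSS leq_subr.
have : 1 < #|~: (val A :|: val B)|.
  rewrite -(leq_add2l #|val A :|: val B|) cardsC card_ord.
  by apply: leq_trans n5; rewrite -[5]/(3 + 2) leq_add2r.
case/card_gt1P => x [y [xU yU xy]].
have c2 : #|[set x; y]| == 2 by rewrite cards2 xy.
pose C : kneser_vertex n 2 := exist _ [set x; y] c2.
move: xU yU; rewrite !inE !negb_or => /andP[xA xB] /andP[yA yB].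
have dC (D : {set 'I_n}) : x \notin D -> y \notin D ->
    [disjoint [set x; y] & D].
  by move=> xD yD; rewrite disjoints_subset subUset !sub1set !inE xD.
apply: (@connect_trans _ _ C); apply: connect1; last exact: dC.
by rewrite kneser_sym; apply: dC.
Qed.

(* Main.v *)
Require Import Defs.
From mathcomp Require Import all_boot.

Set Implicit Arguments.
Unset Strict Implicit.
Unset Printing Implicit Defensive.

(** The vertices of KG(n,2) are the edges of the complete graph on n points,
    two of them being adjacent when they are disjoint. For n >= 5 the only
    pairs at distance greater than 1 are the pairs ab, ac of edges with one
    common point; they are at distance 2, and their common neighbours are the
    edges missing {a, b, c}. Visibility of ab and ac thus means that the
    complement Y of the set X, viewed as a graph on the n points, has an edge
    missing {a, b, c} ([visible_dist2]).

    So X is a total mutual-visibility set exactly when no 3-set of points is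
    a vertex cover of Y. A matching with four edges has this property, and
    exists because n >= 8; this gives a total mutual-visibility set with
    'C(n, 2) - 4 elements ([total_visibility_co_matching]).

    Conversely, if Y has at most three edges, then it has a vertex cover
    {a, b, c} such that neither ab nor ac is an edge of Y ([sparse_cover]).
    Then ab and ac belong to X and are not X-visible, so X is not even a
    mutual-visibility set ([mutual_visibility_codim]).

    Since a total mutual-visibility set is also dual and outer, and each of
    these is a mutual-visibility set, the four numbers lie between the bounds
    just obtained. *)

(** * Visibility at distance at most two *)

Section Visibility.
Variables (T : finType) (e : rel T).
Implicit Types (X : {set T}) (u v w : T).

Lemma visible_refl X u : visible e X u u.
Proof.
apply/visibleP; exists [::]; last by rewrite /avoids /= !inE eqxx implybT.
by apply/shortest_pathP; split; rewrite // /upath /= eqxx.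
Qed.

Lemma visible_adj X u v : u != v -> e u v -> visible e X u v.
Proof.
move=> uv euv; apply/visibleP; exists [:: v]; last first.
  by rewrite /avoids /= !inE !eqxx orbT !implybT.
apply/shortest_pathP; split; first by rewrite /upath /= euv eqxx inE uv.
by case=> // /and3P[_ /= uv' _]; rewrite uv' in uv.
Qed.

(** The common neighbour w0 pins the distance to 2, so that every shortest path
    consists of u, a common neighbour w, and v. Such a path has no repetition
    because w = u or w = v would make u and v adjacent. *)
Lemma visible_dist2 X u v w0 : u != v -> ~~ e u v -> e u w0 -> e w0 v ->
  reflect (exists w, [/\ e u w, e w v & w \notin X]) (visible e X u v).
Proof.
move=> uv nuv uw0 w0v.
have up w : e u w -> e w v -> upath e u v [:: w; v].
  move=> uw wv; rewrite /upath /= uw wv eqxx !inE negb_or uv !andbT /=.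
  by apply/andP; split; [apply: contraNneq nuv => ->|apply: contraNneq nuv => <-].
apply: (iffP (visibleP _ _ _ _)) => [[p /shortest_pathP[pP pmin] pX]|].
  have := pmin _ (up _ uw0 w0v).
  case: p pP pX {pmin} => [|w [|v' []]] //; rewrite /upath /=.
  - by rewrite (negPf uv).
  - by case/and3P=> /andP[uw _] /eqP wv; rewrite -wv uw in nuv.
  case/and3P=> /and3P[uw wv _] /eqP v'v; rewrite {}v'v in wv *.
  rewrite !inE negb_or => /and3P[/andP[uw' _] wv' _].
  rewrite /avoids /= !inE => /and3P[_ + _] _.
  rewrite eq_sym (negPf uw') (negPf wv') implybF => wX.
  by exists w.
case=> w [uw wv wX]; exists [:: w; v]; last first.
  by rewrite /avoids /= !inE !eqxx orbT !implybT (negPf wX).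
apply/shortest_pathP; split=> [|[|w' [|]] //]; first exact: up.
  by rewrite /upath /= (negPf uv).
by case/and3P=> /andP[uw' _] /eqP /= wv'; rewrite -wv' uw' in nuv.
Qed.

Lemma total_outer X :
  total_mutual_visibility_set e X -> outer_mutual_visibility_set e X.
Proof.
move=> /forallP XP; apply/forallP=> u; apply/forallP=> v.
by rewrite (forallP (XP u)) implybT.
Qed.

Lemma total_dual X :
  total_mutual_visibility_set e X -> dual_mutual_visibility_set e X.
Proof.
move=> /forallP XP; apply/andP.
by split; apply/forall_inP=> u _; apply/forall_inP=> v _; exact: (forallP (XP u)).
Qed.

Lemma outer_mutual X :
  outer_mutual_visibility_set e X -> mutual_visibility_set e X.
Proof.
move=> /forallP XP; apply/forall_inP=> u uX; apply/forall_inP=> v _.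
by have /forallP/(_ v) := XP u; rewrite uX.
Qed.

Lemma dual_mutual X :
  dual_mutual_visibility_set e X -> mutual_visibility_set e X.
Proof. by case/andP. Qed.

End Visibility.

Lemma leq_bigmax_pred (I : finType) (P Q : pred I) (F : I -> nat) :
  (forall i, P i -> Q i) -> \max_(i | P i) F i <= \max_(i | Q i) F i.
Proof. by move=> PQ; apply/bigmax_leqP=> i /PQ; apply: leq_bigmax_cond. Qed.

Lemma card_le3_sub (T : finType) (x0 : T) (Y : {set T}) :
  #|Y| <= 3 -> exists x y z, Y \subset [set x; y; z].
Proof.
rewrite cardE => Y3; pose y i := nth x0 (enum Y) i.
exists (y 0), (y 1), (y 2); apply/subsetP=> t; rewrite -mem_enum !inE -orbA /y.
by case: (enum Y) Y3 => [|a [|b [|c []]]] //= _; rewrite !inE // ?orbA => ->.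
Qed.

(** * Vertex covers of graphs with three edges *)

Section SparseGraphs.
Variable n : nat.
Implicit Types e : {set 'I_n}.

Definition meets3 (a b c : 'I_n) e := [|| a \in e, b \in e | c \in e].

(** The properties of a, b, c needed to make ab and ac non-visible when e1, e2
    and e3 are the only vertices outside X. *)
Definition blocked e1 e2 e3 := exists a b c : 'I_n,
  [/\ [/\ a != b, a != c & b != c],
      [/\ meets3 a b c e1, meets3 a b c e2 & meets3 a b c e3],
      [set a; b] \notin [:: e1; e2; e3] & [set a; c] \notin [:: e1; e2; e3]].

(** A point x common to two of the edges and a further point y of the third
    one already cover everything, so the third point z of the cover is free;
    chosen off the at most six points of the three edges, it prevents zx and
    zy from being among them. *)
Lemma blocked_meet e1 e2 e3 : 6 < n -> #|e1| = 2 -> #|e2| = 2 -> #|e3| = 2 ->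
  ~~ [disjoint e1 & e2] -> blocked e1 e2 e3.
Proof.
move=> n6 c1 c2 c3; rewrite -setI_eq0 => /set0Pn[x /setIP[x1 x2]].
have [y y3 yx] : exists2 y, y \in e3 & y != x.
  have : 0 < #|e3 :\ x|.
    by rewrite -(ltn_add2l (x \in e3)) -cardsD1 c3 addn0; case: (x \in e3).
  by case/card_gt0P=> y; rewrite !inE => /andP[yx y3]; exists y.
have [z zP] : exists z, z \notin e1 :|: e2 :|: e3.
  have : 0 < #|~: (e1 :|: e2 :|: e3)|.
    have leU (A B : {set 'I_n}) : #|A :|: B| <= #|A| + #|B|.
      by rewrite cardsU leq_subr.
    have U6 : #|e1 :|: e2 :|: e3| <= 6.
      apply: leq_trans (leU _ _) _; rewrite c3 -[6]/(4 + 2) leq_add2r.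
      by apply: leq_trans (leU _ _) _; rewrite c1 c2.
    have := cardsC (e1 :|: e2 :|: e3); rewrite card_ord lt0n => cU.
    by apply/eqP=> c0; rewrite -cU c0 addn0 ltnNge U6 in n6.
  by case/card_gt0P=> z; rewrite inE; exists z.
move: zP; rewrite !inE !negb_or => /andP[/andP[z1 z2] z3].
have new t : [set z; t] \notin [:: e1; e2; e3].
  have nz e : z \notin e -> [set z; t] != e.
    by apply: contraNneq => <-; rewrite set21.
  by rewrite !inE !negb_or !nz.
exists z, x, y; split=> //.
- split; last by rewrite eq_sym.
  + by apply: contraNneq z1 => ->.
  + by apply: contraNneq z3 => ->.
- by rewrite /meets3 x1 x2 y3 !orbT.
Qed.

Lemma blocked_rot e1 e2 e3 : blocked e1 e2 e3 -> blocked e2 e3 e1.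
Proof.
have rotE e : (e \in [:: e2; e3; e1]) = (e \in [:: e1; e2; e3]).
  by rewrite -(mem_rot 1 [:: e1; e2; e3]).
by case=> a [b [c [abc [m1 m2 m3] ab ac]]]; exists a, b, c; rewrite !rotE.
Qed.

(** If two of the edges meet, this is [blocked_meet]. If the edges are pairwise
    disjoint, any transversal works, since an edge joining two of its points
    meets two of the given edges and so is none of them. *)
Lemma sparse_cover e1 e2 e3 :
  6 < n -> #|e1| = 2 -> #|e2| = 2 -> #|e3| = 2 -> blocked e1 e2 e3.
Proof.
move=> n6 c1 c2 c3.
have [d12|] := boolP [disjoint e1 & e2]; last by apply: blocked_meet.
have [d23|m23] := boolP [disjoint e2 & e3]; last first.
  by do 2!apply: blocked_rot; apply: blocked_meet.
have [d31|m31] := boolP [disjoint e3 & e1]; last first.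
  by apply: blocked_rot; apply: blocked_meet.
have pt e : #|e| = 2 -> exists x, x \in e.
  by move=> ce; apply/card_gt0P; rewrite ce.
have [a a1] := pt _ c1; have [b b2] := pt _ c2; have [c c3'] := pt _ c3.
have a2 := disjointFr d12 a1; have a3 := disjointFl d31 a1.
have b1 := disjointFl d12 b2; have b3 := disjointFr d23 b2.
have c1' := disjointFr d31 c3'; have c2' := disjointFl d23 c3'.
have new x y e : (x \in e) && (y \in e) = false -> ([set x; y] == e) = false.
  by apply: contraFF => /eqP <-; rewrite set21 set22.
exists a, b, c; split.
- split; first by apply: contraFneq b1 => <-.
  + by apply: contraFneq c1' => <-.
  + by apply: contraFneq c2' => <-.
- by rewrite /meets3 a1 b2 c3' !orbT.
- by rewrite !inE !new // ?a2 ?a3 ?b1 ?andbF.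
- by rewrite !inE !new // ?a2 ?a3 ?c1' ?andbF.
Qed.

End SparseGraphs.

(** * Mutual visibility in Kneser graphs of pairs *)

Section KneserGraph.
Variable n : nat.
Local Notation vertex := (kneser_vertex n 2).
Implicit Types (u v w : vertex) (X : {set vertex}).

Lemma card_kneser_vertex : #|vertex| = 'C(n, 2).
Proof. by rewrite card_sig -[n in RHS]card_ord -card_draws cardsE. Qed.

Lemma kneser_pair (x y : 'I_n) : x != y -> exists u : vertex, val u = [set x; y].
Proof.
move=> xy; have c2 : #|[set x; y]| == 2 by rewrite cards2 xy.
by exists (exist _ [set x; y] c2).
Qed.

Lemma kneser_avoid (S : {set 'I_n}) :
  #|S|.+1 < n -> exists w : vertex, [disjoint S & val w].
Proof.
move=> Sn; have : 1 < #|~: S|.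
  by rewrite -(ltn_add2l #|S|) cardsC card_ord addn1.
case/card_gt1P=> x [y [xS yS /kneser_pair[w wE]]]; exists w.
rewrite wE disjoint_sym disjoints_subset.
by apply/subsetP=> z /set2P[] ->.
Qed.

Lemma kneser_nadj_cardU u v : ~~ KG u v -> #|val u :|: val v| <= 3.
Proof.
rewrite /KG -setI_eq0 -card_gt0 => I0.
rewrite cardsU (eqP (valP u)) (eqP (valP v)) leq_subLR.
exact: (leq_add I0 (leqnn 3)).
Qed.

(** Three vertices outside X cannot unblock the paths between all pairs ab, ac
    of [sparse_cover]. When fewer than three vertices lie outside X, the list
    is padded by an arbitrary vertex, which at most enlarges the set of edges
    to be covered and the set of pairs to be avoided. *)
Lemma mutual_visibility_codim X :
  6 < n -> mutual_visibility_set (@KG n 2) X -> 4 <= #|~: X|.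
Proof.
move=> n6 /forall_inP XP; rewrite ltnNge; apply/negP.
have [u0 _] : exists w : vertex, [disjoint set0 & val w].
  by apply: kneser_avoid; rewrite cards0; apply: leq_trans n6.
case/(card_le3_sub u0) => e1 [e2 [e3 /subsetP Ysub]].
have YE w : w \notin X -> val w \in [:: val e1; val e2; val e3].
  by move=> wX; have := Ysub w; rewrite !inE !val_eqE -orbA; apply.
have inX w : val w \notin [:: val e1; val e2; val e3] -> w \in X.
  by apply: contraR; apply: YE.
have c2 w : #|val w| = 2 by apply/eqP; exact: (valP w).
have [a [b [c [[ab ac bc] [m1 m2 m3] abY acY]]]] :=
  sparse_cover n6 (c2 e1) (c2 e2) (c2 e3).
have [u uE] := kneser_pair ab; have [v vE] := kneser_pair ac.
have uX : u \in X by apply: inX; rewrite uE.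
have vX : v \in X by apply: inX; rewrite vE.
have uv : u != v.
  apply/eqP => uv; have : b \in val v by rewrite -uv uE set22.
  by rewrite vE !inE eq_sym (negPf ab) (negPf bc).
have nuv : ~~ KG u v.
  by rewrite /KG -setI_eq0; apply/set0Pn; exists a; rewrite uE vE !inE eqxx.
have [w0] : exists w : vertex, [disjoint val u :|: val v & val w].
  apply: kneser_avoid; apply: leq_trans (ltnW (ltnW n6)).
  by rewrite !ltnS kneser_nadj_cardU.
rewrite disjoints_subset subUset -!disjoints_subset => /andP[uw0 vw0].
have /forall_inP/(_ _ vX)/(visible_dist2 _ uv nuv uw0)[] := XP _ uX.
  by rewrite kneser_sym.
move=> w [uw]; rewrite kneser_sym /KG => vw /YE wY.
have : meets3 a b c (val w) by move: wY; rewrite !inE => /or3P[] /eqP ->.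
rewrite /meets3 (disjointFr uw) ?uE ?set21 //.
by rewrite (disjointFr uw) ?uE ?set22 // (disjointFr vw) ?vE ?set22.
Qed.

(** Every pair of non-adjacent vertices spans at most three points, which
    cannot meet four disjoint edges; the matching used here consists of the
    sets {2i, 2i+1} for i < 4, the fibres of halving. *)
Lemma total_visibility_co_matching : 7 < n ->
  exists2 X, total_mutual_visibility_set (@KG n 2) X & 'C(n, 2) - 4 <= #|X|.
Proof.
move=> n7.
have card_half (i : 'I_4) : #|[set x : 'I_n | x./2 == i]| == 2.
  have lt1 : i.*2.+1 < n.
    by apply: leq_trans n7; rewrite -doubleS -[8]/4.*2 leq_double.
  have -> : [set x : 'I_n | x./2 == i] = [set Ordinal (ltnW lt1); Ordinal lt1].
    apply/setP=> x; rewrite !inE -!val_eqE /=.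
    apply/eqP/orP=> [<-|[] /eqP ->]; rewrite /= ?uphalf_double ?doubleK //.
    rewrite -[X in X == _]odd_double_half -[X in _ \/ X == _]odd_double_half.
    by case: (odd x); [right|left].
  by rewrite cards2 -val_eqE /= neq_ltn ltnSn.
pose m (i : 'I_4) : vertex := exist _ [set x : 'I_n | x./2 == i] (card_half i).
exists (~: [set m i | i : 'I_4]); last first.
  rewrite leq_subLR -card_kneser_vertex -(cardsC [set m i | i : 'I_4]).
  by rewrite leq_add2r (leq_trans (leq_imset_card _ _)) ?card_ord.
apply/forallP=> u; apply/forallP=> v.
have [<-|uv] := eqVneq u v; first exact: visible_refl.
have [|nuv] := boolP (KG u v); first exact: visible_adj.
have U3 := kneser_nadj_cardU nuv.
have [i iP] : exists i, [disjoint val u :|: val v & val (m i)].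
  pose s := [seq (x : 'I_n)./2 | x <- enum (val u :|: val v)].
  have : ~~ all (mem s) (iota 0 4).
    apply: contraL U3 => /allP s4; rewrite -ltnNge cardE.
    by have := uniq_leq_size (iota_uniq 0 4) s4; rewrite size_map.
  case/allPn=> i; rewrite mem_iota => i4 si; exists (Ordinal i4).
  rewrite disjoints_subset; apply/subsetP=> x xU; rewrite !inE /=.
  by apply: contra si => /eqP <-; apply: map_f; rewrite mem_enum.
move: iP; rewrite disjoints_subset subUset -!disjoints_subset => /andP[um vm].
apply/(visible_dist2 _ uv nuv um); first by rewrite kneser_sym.
exists (m i); split=> //; first by rewrite kneser_sym.
by rewrite inE negbK imset_f.
Qed.

End KneserGraph.

Theorem proposition17 (n : nat) (hn : 8 <= n) :
  [/\ mu (@KG n 2) = mu_d (@KG n 2),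
      mu_d (@KG n 2) = mu_o (@KG n 2),
      mu_o (@KG n 2) = mu_t (@KG n 2)
    & mu_t (@KG n 2) = 'C(n, 2) - 4].
Proof.
set N := 'C(n, 2) - 4.
have mu_le : mu (@KG n 2) <= N.
  apply/bigmax_leqP=> X /mutual_visibility_codim-/(_ (ltnW hn)) X4.
  rewrite /N -card_kneser_vertex -(cardsC X) -(leq_add2r 4).
  by rewrite subnK ?leq_add2l // (leq_trans X4) ?leq_addl.
have mu_t_ge : N <= mu_t (@KG n 2).
  have [X Xt NX] := total_visibility_co_matching hn.
  exact: leq_trans NX (leq_bigmax_cond _ Xt).
have td : mu_t (@KG n 2) <= mu_d (@KG n 2).
  by apply: leq_bigmax_pred => X; apply: total_dual.
have to : mu_t (@KG n 2) <= mu_o (@KG n 2).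
  by apply: leq_bigmax_pred => X; apply: total_outer.
have dm : mu_d (@KG n 2) <= mu (@KG n 2).
  by apply: leq_bigmax_pred => X; apply: dual_mutual.
have om : mu_o (@KG n 2) <= mu (@KG n 2).
  by apply: leq_bigmax_pred => X; apply: outer_mutual.
have eqN k : mu_t (@KG n 2) <= k -> k <= mu (@KG n 2) -> k = N.
  move=> tk km; apply/eqP.
  by rewrite eqn_leq (leq_trans km mu_le) (leq_trans mu_t_ge tk).
have tm := leq_trans td dm.
by rewrite (eqN _ tm) // (eqN _ td dm) (eqN _ to om) (eqN _ (leqnn _) tm).
Qed.
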